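(* Let $(g_n(\lambda))_{n\ge 0}$ be the sequence of polynomials in $\lambda$ defined by $g_0(\lambda)=1$ and, for $n\ge 1$, $$g_{n}(\lambda) = (2-\lambda)g_{n-1}(\lambda) + \sum_{i=2}^{n}(-1)^{i+1}2^{2i-1}g_{n-i}(\lambda).$$ Then for all $n\ge 0$, $$g_{n}(\lambda) = \sum_{t=0}^{n}\sum_{k=t}^{n}(-1)^k\binom{k}{t}\binom{t+1}{n-k}2^{2n-t-k}\lambda^{t}.$$
   Context: Empty sums are $0$; $\binom{a}{b}=0$ for integers $0\le a<b$. *)

(* Defs.v *)
From mathcomp Require Export all_boot all_order all_algebra.

(* Main.v *)
Require Import Defs.
From mathcomp Require Import all_boot all_order all_algebra.
From mathcomp Require Import ring zify.
Import GRing.Theory.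
Local Open Scope ring_scope.

(** Multiplying the generating series [G = \sum_n g_n x^n] by the geometric
    denominator [1 + 4 x] of the defining recurrence gives
    [G = (1 + 4 x) / (1 + 2 x + 'X x (1 + 4 x))], that is
    [g_(n+2) = - (2 + 'X) g_(n+1) - 4 'X g_n].  Expanding in powers of ['X],
    the coefficient of ['X^t] in [G] is the product of
    [(- x)^t / (1 + 2 x)^(t+1)] and [(1 + 4 x)^(t+1)], whose [x]-coefficients
    are [negbin_coef t] and [bin_coef t]; the claimed formula is their Cauchy
    product. *)

Definition conv {R : comNzRingType} (p q : nat -> R) (n : nat) : R :=
  \sum_(i < n.+1) p i * q (n - i)%N.

(** Truncation in [k - t] is harmless: for [k < t] the binomial factor vanishes. *)
Definition negbin_coef {R : comNzRingType} (t k : nat) : R :=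
  (-1) ^+ k * 'C(k, t)%:R * 2 ^+ (k - t).

Definition bin_coef {R : comNzRingType} (t m : nat) : R :=
  'C(t.+1, m)%:R * 4 ^+ m.

Definition row_coef {R : comNzRingType} (t : nat) : nat -> R :=
  conv (negbin_coef t) (bin_coef t).

Section Coefficients.
Variable R : comNzRingType.
Implicit Types (p q : nat -> R) (t k m n : nat).

Lemma convSl p q n :
  conv p q n.+1 = p 0%N * q n.+1 + conv (fun i => p i.+1) q n.
Proof. by rewrite /conv big_ord_recl. Qed.

Lemma convSr p q n :
  conv p q n.+1 = conv p (fun i => q i.+1) n + p n.+1 * q 0%N.
Proof.
rewrite /conv big_ord_recr /= subnn; congr (_ + _).
by apply: eq_bigr => i _; rewrite subSn // -ltnS.
Qed.

Lemma conv_lincombl (a b : R) p p' q n :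
  conv (fun i => a * p i + b * p' i) q n = a * conv p q n + b * conv p' q n.
Proof.
rewrite /conv !mulr_sumr -big_split /=.
by apply: eq_bigr => i _; ring.
Qed.

Lemma conv_lincombr (a b : R) p q q' n :
  conv p (fun i => a * q i + b * q' i) n = a * conv p q n + b * conv p q' n.
Proof.
rewrite /conv !mulr_sumr -big_split /=.
by apply: eq_bigr => i _; ring.
Qed.

Lemma eq_conv p p' q q' n : p =1 p' -> q =1 q' -> conv p q n = conv p' q' n.
Proof. by move=> pE qE; apply: eq_bigr => i _; rewrite pE qE. Qed.

Lemma negbin_coef0S k : negbin_coef 0 k.+1 = -2 * negbin_coef 0 k :> R.
Proof. by rewrite /negbin_coef !bin0 !subn0 !exprS; ring. Qed.

(** Raising [t] multiplies the series by [- x / (1 + 2 x)]; clearing the denominator gives this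
    Pascal-type rule. *)
Lemma negbin_coefSS t k :
  negbin_coef t.+1 k.+1 = -1 * negbin_coef t k + -2 * negbin_coef t.+1 k :> R.
Proof.
rewrite /negbin_coef binS natrD subSS exprS.
(* [2 * 2 ^+ (k - t.+1) = 2 ^+ (k - t)] needs [t < k]; otherwise ['C(k, t.+1) = 0] removes that
   term. *)
have [lt_tk | le_kt] := ltnP t k; last by rewrite bin_small ?ltnS //; ring.
by rewrite -[(k - t)%N]prednK ?subn_gt0 // -subnS exprS; ring.
Qed.

Lemma bin_coefSS t m :
  bin_coef t.+1 m.+1 = 1 * bin_coef t m.+1 + 4 * bin_coef t m :> R.
Proof. by rewrite /bin_coef binS natrD exprS; ring. Qed.

Lemma row_coef0_0 : row_coef 0 0 = 1 :> R.
Proof.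
by rewrite /row_coef /conv big_ord1 /negbin_coef /bin_coef !bin0 !expr0; ring.
Qed.

Lemma row_coef0_S n :
  row_coef 0 n.+1 = 'C(1, n.+1)%:R * 4 ^+ n.+1 - 2 * row_coef 0 n :> R.
Proof.
rewrite /row_coef convSl.
(* The dummy summand [0 * 0] gives the shape required by [conv_lincombl]. *)
have p0S k : negbin_coef 0 k.+1 = -2 * negbin_coef 0 k + 0 * 0 :> R.
  by rewrite negbin_coef0S; ring.
rewrite (eq_conv _ _ _ _ _ p0S (frefl _)) conv_lincombl.
by rewrite /negbin_coef /bin_coef bin0 !expr0; ring.
Qed.

Lemma row_coef_small t n : (n < t)%N -> row_coef t n = 0 :> R.
Proof.
move=> lt_nt; apply: big1 => i _.
rewrite /negbin_coef bin_small ?mulr0 ?mul0r //.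
exact: leq_ltn_trans (leq_ord i) lt_nt.
Qed.

(** With [F_t] the series of row [t], this is the coefficient of [x^(n+2)] in
    [(1 + 2 x) F_(t+1) = - x (1 + 4 x) F_t]. *)
Lemma row_coefSS t n :
  row_coef t.+1 n.+2
  = -2 * row_coef t.+1 n.+1 - row_coef t n.+1 - 4 * row_coef t n :> R.
Proof.
have conv_binS : conv (negbin_coef t) (bin_coef t.+1) n.+1
    = row_coef t n.+1 + 4 * row_coef t n :> R.
  rewrite convSr (eq_conv _ _ _ _ _ (frefl _) (bin_coefSS t)) conv_lincombr.
  by rewrite /row_coef convSr /bin_coef !bin0; ring.
rewrite {1}/row_coef convSl.
rewrite (eq_conv _ _ _ _ _ (negbin_coefSS t) (frefl _)) conv_lincombl.
rewrite conv_binS -/(row_coef t.+1 n.+1).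
by rewrite [negbin_coef _ 0]/negbin_coef bin0n /=; ring.
Qed.

Lemma row_coefE t n : (t <= n)%N ->
  row_coef t n = \sum_(t <= k < n.+1)
    (-1) ^+ k * 'C(k, t)%:R * 'C(t + 1, n - k)%:R * 2 ^+ (2 * n - t - k) :> R.
Proof.
move=> le_tn; rewrite /row_coef /conv.
rewrite -(big_mkord xpredT (fun k => negbin_coef t k * bin_coef t (n - k))) /=.
rewrite (@big_cat_nat _ _ _ t) //=; last exact: leqW.
rewrite big_nat_cond big1 ?add0r => [|k /andP[/andP[_ lt_kt] _]]; last first.
  by rewrite /negbin_coef bin_small // mulr0 !mul0r.
rewrite big_nat_cond [RHS]big_nat_cond; apply: eq_bigr => k.
rewrite ltnS => /andP[/andP[le_tk le_kn] _].
(* Valid for truncated subtraction since [t <= k <= n]; it splits off [4 ^+ (n - k)]. *)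
have -> : (2 * n - t - k = (k - t) + 2 * (n - k))%N by lia.
rewrite /negbin_coef /bin_coef addn1 exprD exprM.
have -> : 2 ^+ 2 = 4 :> R by ring.
by ring.
Qed.

End Coefficients.

Lemma two_term_recurrence (R : comNzRingType) (g : nat -> {poly R})
  (gE : forall n : nat, (1 <= n)%N ->
     g n = (2 - 'X) * g (n - 1)%N
           + \sum_(2 <= i < n.+1) (-1) ^+ (i + 1) * 2 ^+ (2 * i - 1) * g (n - i)%N)
  (n : nat) :
  g n.+2 = -2 * g n.+1 - 'X * g n.+1 - 4 * ('X * g n).
Proof.
pose S m := \sum_(2 <= i < m.+1)
  (-1) ^+ (i + 1) * 2 ^+ (2 * i - 1) * g (m - i)%N : {poly R}.
have gS m : g m.+1 = (2 - 'X) * g m + S m.+1 by rewrite gE // subn1.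
(* Successive weights have ratio [-4], so only the [i = 2] term, of weight [-8], is new; the
   recurrence for [g n.+1] then eliminates [S n.+1]. *)
have SS : S n.+2 = - 8 * g n - 4 * S n.+1.
  rewrite /S big_nat_recl //; congr (_ + _).
    by rewrite (_ : 2 * 2 - 1 = 3)%N // !subSS subn0; ring.
  rewrite mulr_sumr -sumrN big_nat_cond [RHS]big_nat_cond.
  apply: eq_bigr => i /andP[/andP[i_ge2 _] _].
  have -> : (2 * i.+1 - 1 = (2 * i - 1).+2)%N by lia.
  by rewrite subSS addSn !exprS; ring.
have -> : g n.+2 = (2 - 'X) * g n.+1 - 8 * g n - 4 * (g n.+1 - (2 - 'X) * g n).
  by rewrite {1}gS SS {3}gS; ring.
by ring.
Qed.

Theorem theorem10 (R : comNzRingType) (g : nat -> {poly R})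
  (g0 : g 0%N = 1)
  (gE : forall n : nat, (1 <= n)%N ->
     g n = (2 - 'X) * g (n - 1)%N
           + \sum_(2 <= i < n.+1) (-1) ^+ (i + 1) * 2 ^+ (2 * i - 1) * g (n - i)%N)
  (n : nat) :
  g n = \sum_(0 <= t < n.+1) \sum_(t <= k < n.+1)
          ((-1) ^+ k * 'C(k, t)%:R * 'C(t + 1, n - k)%:R
             * 2 ^+ (2 * n - t - k)) *: 'X^t.
Proof.
(* The recurrence has order two, so the induction carries two consecutive indices. *)
have coef_g m : (forall t, (g m)`_t = row_coef t m)
              /\ (forall t, (g m.+1)`_t = row_coef t m.+1).
  elim: m => [|m [IHm IHm1]].
    split=> t.
      rewrite g0 coef1; case: t => [|t]; first by rewrite row_coef0_0.
      by rewrite row_coef_small.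
    rewrite gE // subnn g0 big_geq // mulr1 addr0 coefB coefX.
    have -> : (2 : {poly R}) = 2%:P by rewrite polyC_natr.
    rewrite coefC; case: t => [|[|t]] /=.
    - by rewrite row_coef0_S row_coef0_0 binn; ring.
    - rewrite /row_coef /conv !big_ord_recl big_ord0 /negbin_coef /bin_coef /=.
      by rewrite bin0n binn !bin0 /=; ring.
    - by rewrite subr0 row_coef_small.
  split=> // t; rewrite two_term_recurrence //.
  have -> : (-2 : {poly R}) = (-2)%:P by rewrite polyCN polyC_natr.
  have -> : (4 : {poly R}) = 4%:P by rewrite polyC_natr.
  rewrite !coefB !coefCM !coefXM IHm1.
  case: t => [|t] /=; last by rewrite IHm IHm1 row_coefSS.
  (* At [t = 0] the multiples of ['X] contribute nothing, and ['C(1, m.+2) = 0]. *)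
  by rewrite [RHS]row_coef0_S bin_small //; ring.
rewrite (@eq_big_nat _ _ _ _ _ _ (fun t => row_coef t n *: 'X^t)); last first.
  by move=> t /andP[_ le_tn]; rewrite -scaler_suml row_coefE.
rewrite big_mkord /= -(poly_def n.+1 (fun t => row_coef t n)); apply/polyP => t.
rewrite coef_poly (coef_g n).1.
by case: ltnP => // lt_nt; rewrite row_coef_small.
Qed.
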